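(* Let $R$ be a Noetherian ring, $I$ an ideal of $R$, and $N \subseteq M$ finitely generated $R$-modules. Then $$\mathrm{Ass}_R(M/I^nN) \smallsetminus V(I) = \mathrm{Ass}_R(M/N) \smallsetminus V(I) \quad \text{for all } n \geq 0.$$
   Context: Rings are commutative. $V(I) := \{\mathfrak{p}\in\mathrm{Spec}(R) : I\subseteq\mathfrak{p}\}$, and $I^0 = R$. *)

(* Defs.v *)
From HB Require Import structures.
From mathcomp Require Import all_boot all_algebra.
From mathcomp Require Import boolp classical_sets.

Set Implicit Arguments.
Unset Strict Implicit.
Unset Printing Implicit Defensive.

Import GRing.Theory.
Local Open Scope classical_set_scope.
Local Open Scope ring_scope.
Local Open Scope quotient_scope.

(* Submodules are boolean predicates, as everywhere in MathComp; in the presence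
   of the axioms of boolp every subset is of this form.  An ideal of R is a
   submodule of the regular module R^o.  The structures idealr and prime_idealr
   of ring_quotient are not used because they only contain proper ideals, of
   nontrivial rings. *)
Notation ideal R := (submodClosed R^o).

Definition fin_gen (R : comPzRingType) (V : lmodType R) (A : set V) : Prop :=
  exists s : seq V,
    A = [set x | exists c : nat -> R, x = \sum_(i < size s) c i *: s`_i].

Definition noetherian (R : comPzRingType) : Prop :=
  forall J : ideal R, fin_gen [set` J].

Section WholeModule.
Variables (R : comPzRingType) (V : lmodType R).

Definition whole : {pred V} := predT.

Lemma whole_submod_closed : submod_closed whole.
Proof. by []. Qed.

HB.instance Definition _ :=
  GRing.isSubmodClosed.Build R V whole whole_submod_closed.

End WholeModule.
Arguments whole {R} V _.

Section IdealAction.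
Variables (R : comPzRingType) (V : lmodType R).
Variables (J : ideal R) (N : submodClosed V).

Definition ideal_smul : {pred V} := fun x => `[< exists s : seq (R * V),
  (forall u, u \in s -> u.1 \in J /\ u.2 \in N)
  /\ x = \sum_(u <- s) u.1 *: u.2 >].

Lemma ideal_smul_submod_closed : submod_closed ideal_smul.
Proof.
split; first by apply/asboolP; exists [::]; rewrite big_nil.
move=> a x y /asboolP[s [sP ->]] /asboolP[t [tP ->]]; apply/asboolP.
exists ([seq (u.1, a *: u.2) | u <- s] ++ t); split.
  move=> u; rewrite mem_cat => /orP[/mapP[v /sP[vJ vN] ->]|/tP//].
  by split=> //=; apply: rpredZ.
rewrite big_cat big_map scaler_sumr; congr (_ + _).
by apply: eq_bigr => u _; rewrite /= !scalerA mulrC.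
Qed.

HB.instance Definition _ :=
  GRing.isSubmodClosed.Build R V ideal_smul ideal_smul_submod_closed.

End IdealAction.

Definition ideal_exp (R : comPzRingType) (J : ideal R) (n : nat) : ideal R :=
  iter n (fun K : ideal R => ideal_smul J K : ideal R) (whole R^o).

Section QuotientModule.
Variables (R : comPzRingType) (V : lmodType R) (N : submodClosed V).

Lemma submod_oppr_closed : oppr_closed N.
Proof. by move=> x Nx; rewrite -scaleN1r rpredZ. Qed.

(* SubmodClosed does not inherit from ZmodClosed in the library, since it is
   also meant for semimodules. *)
Definition submod_zmod : zmodClosed V :=
  HB.pack (GRing.SubmodClosed.sort N)
    (GRing.isOppClosed.Build V (GRing.SubmodClosed.sort N) submod_oppr_closed).

Definition quotmod : Type := {ideal_quot submod_zmod}.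

HB.instance Definition _ := GRing.Zmodule.on quotmod.
HB.instance Definition _ := EqQuotient.on quotmod.

Definition quotmod_scale (a : R) (x : quotmod) : quotmod :=
  \pi_quotmod (a *: repr x).

Lemma pi_quotmodD (x y : V) :
  \pi_quotmod (x + y) = \pi_quotmod x + \pi_quotmod y.
Proof. exact: (@Quotient.pi_add V submod_zmod x y). Qed.

Lemma eq_quotmod (x y : V) :
  (\pi_quotmod x = \pi_quotmod y) <-> (x - y \in N).
Proof.
have E : (x - y \in N) = (\pi_quotmod x == \pi_quotmod y).
  exact: (@Quotient.idealrBE V submod_zmod x y).
by rewrite E; split=> /eqP.
Qed.

Lemma quotmod_ex (x : quotmod) : exists y : V, x = \pi_quotmod y.
Proof. by exists (repr x); rewrite reprK. Qed.

Lemma pi_quotmodZ (a : R) (x : V) :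
  quotmod_scale a (\pi_quotmod x) = \pi_quotmod (a *: x).
Proof.
apply/eq_quotmod; rewrite -scalerBr rpredZ //.
by apply/eq_quotmod; rewrite reprK.
Qed.

Lemma quotmod_scalerA a b x :
  quotmod_scale a (quotmod_scale b x) = quotmod_scale (a * b) x.
Proof. by have [y ->] := quotmod_ex x; rewrite !pi_quotmodZ scalerA. Qed.

Lemma quotmod_scale1r : left_id 1 quotmod_scale.
Proof. by move=> x; have [y ->] := quotmod_ex x; rewrite pi_quotmodZ scale1r. Qed.

Lemma quotmod_scalerDr : right_distributive quotmod_scale +%R.
Proof.
move=> a x y; have [u ->] := quotmod_ex x; have [v ->] := quotmod_ex y.
by rewrite -pi_quotmodD !pi_quotmodZ scalerDr pi_quotmodD.
Qed.

Lemma quotmod_scalerDl x : {morph quotmod_scale^~ x : a b / a + b}.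
Proof.
by move=> a b; have [y ->] := quotmod_ex x; rewrite !pi_quotmodZ scalerDl pi_quotmodD.
Qed.

HB.instance Definition _ := GRing.Zmodule_isLmodule.Build R quotmod
  quotmod_scalerA quotmod_scale1r quotmod_scalerDr quotmod_scalerDl.

End QuotientModule.

Definition prime_ideal (R : comPzRingType) (p : ideal R) : Prop :=
  1 \notin p /\ forall a b : R, a * b \in p -> a \in p \/ b \in p.

Record Spec (R : comPzRingType) := MkSpec {
  spec_ideal :> ideal R;
  spec_prime : prime_ideal spec_ideal
}.

Definition V (R : comPzRingType) (J : ideal R) : set (Spec R) :=
  [set p | {subset J <= (p : ideal R)}].

Definition ann (R : comPzRingType) (W : lmodType R) (x : W) : set R :=
  [set a | a *: x = 0].

Definition Ass (R : comPzRingType) (W : lmodType R) : set (Spec R) :=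
  [set p | exists x : W, [set` (p : ideal R)] = ann x].
Arguments Ass : clear implicits.

(* Main.v *)
Require Import Defs.
From mathcomp Require Import all_boot all_algebra.
From mathcomp Require Import boolp classical_sets.
Import GRing.Theory.
Local Open Scope classical_set_scope.
Local Open Scope ring_scope.

(** If [p] is a prime not containing [I], pick [a] in [I] outside [p]; then
    [s = a ^+ n] lies in [I^n] but not in [p], and [s N <= I^n N <= N].
    Since [s] is a nonzerodivisor modulo [p], [p = (I^n N : x)] gives
    [p = (N : x)], and [p = (N : x)] gives [p = (I^n N : s x)]. *)

Lemma mem_ideal_smul (R : comPzRingType) (W : lmodType R) (J : ideal R)
    (N : submodClosed W) (a : R) (x : W) :
  a \in J -> x \in N -> a *: x \in ideal_smul J N.
Proof.
move=> Ja Nx; apply/asboolP; exists [:: (a, x)]; rewrite big_seq1; split=> //.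
by move=> u; rewrite mem_seq1 => /eqP ->.
Qed.

Lemma ideal_smul_sub (R : comPzRingType) (W : lmodType R) (J : ideal R)
    (N : submodClosed W) : {subset ideal_smul J N <= N}.
Proof.
move=> x /asboolP[s [sP ->]]; rewrite big_seq; apply: rpred_sum => u us.
by apply: rpredZ; have [] := sP u us.
Qed.

Lemma exp_mem_ideal_exp (R : comPzRingType) (J : ideal R) (a : R) (n : nat) :
  a \in J -> a ^+ n \in ideal_exp J n.
Proof.
move=> Ja; elim: n => [|n IHn] //; rewrite exprS.
(* The next power is [J] times the previous one, seen as a submodule of [R^o], where scaling is ring
   multiplication. *)
exact: (@mem_ideal_smul R R^o).
Qed.

Lemma exp_notin_prime (R : comPzRingType) (p : Spec R) (a : R) (n : nat) :
  a \notin (p : ideal R) -> a ^+ n \notin (p : ideal R).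
Proof.
have [p1 pM] := spec_prime p; move=> pa; elim: n => [|n IHn] //.
by apply/negP; rewrite exprS => /pM[|]; apply/negP.
Qed.

(** Every class in the quotient has a representative, so annihilators there are exactly the colon
    ideals [(N : x)] with [x] in [W]; this moves all later work into [W]. *)
Lemma AssP (R : comPzRingType) (W : lmodType R) (N : submodClosed W)
    (p : Spec R) :
  Ass R (quotmod N) p <->
  exists x : W, forall r : R, r \in (p : ideal R) <-> r *: x \in N.
Proof.
have annE (x : W) (r : R) :
    r *: (\pi_(quotmod N)%qT x : quotmod N) = 0 <-> r *: x \in N.
  have -> : r *: (\pi_(quotmod N)%qT x : quotmod N)
      = \pi_(quotmod N)%qT (r *: x) by exact: pi_quotmodZ.
  (* Additivity makes the class of [0] idempotent, hence zero by cancellation. *)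
  have <- : \pi_(quotmod N)%qT 0 = 0 :> quotmod N.
    by apply: (addrI (\pi_(quotmod N)%qT 0)); rewrite -pi_quotmodD !addr0.
  by rewrite eq_quotmod subr0.
split=> [[y]|[x px]].
  have [x ->] := quotmod_ex y; move=> /seteqP[px xp]; exists x => r.
  by split=> [/px/annE|/annE/xp].
exists (\pi_(quotmod N)%qT x); apply/seteqP.
by split=> r; rewrite /ann /= annE => /px.
Qed.

Lemma Ass_quotmod_ideal_smul (R : comPzRingType) (W : lmodType R)
    (J : ideal R) (N : submodClosed W) (p : Spec R) (s : R) :
  s \in J -> s \notin (p : ideal R) ->
  Ass R (quotmod (ideal_smul J N)) p <-> Ass R (quotmod N) p.
Proof.
move=> Js ps; have [_ pM] := spec_prime p.
have pMs r : s * r \in (p : ideal R) -> r \in (p : ideal R).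
  by case/pM => // sp; rewrite sp in ps.
rewrite !AssP; split=> -[x px].
  (* The same [x] works: if [r *: x] is in [N], then [s * r] sends [x] into [J N], so [s * r], and
     hence [r], lies in [p]. *)
  exists x => r; split=> [/px/ideal_smul_sub//|Nrx].
  by apply: pMs; apply/px; rewrite -scalerA; apply: mem_ideal_smul.
(* The extra factor [s] pushes [r *: x] from [N] into [J N]; conversely it is cancelled modulo [p]
   by [pMs]. *)
exists (s *: x) => r; rewrite scalerA mulrC; split=> [/px Nrx|].
  by rewrite -scalerA; apply: mem_ideal_smul.
by move/ideal_smul_sub/px/pMs.
Qed.

Theorem proposition2p8 (R : comPzRingType) (I : ideal R) (M : lmodType R)
    (N : submodClosed M) :
  noetherian R -> fin_gen [set: M] -> fin_gen [set` N] ->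
  forall n : nat,
    Ass R (quotmod (ideal_smul (ideal_exp I n) N)) `\` V I
    = Ass R (quotmod N) `\` V I.
Proof.
move=> _ _ _ n.
have AssE p : ~ V I p ->
    Ass R (quotmod (ideal_smul (ideal_exp I n) N)) p <-> Ass R (quotmod N) p.
  (* The element [a] witnesses that [I] is not contained in [p]. *)
  move=> /existsNP[a /not_implyP[Ia /negP pa]].
  apply: (Ass_quotmod_ideal_smul R M _ N p ((a : R) ^+ n)).
    exact: exp_mem_ideal_exp.
  exact: exp_notin_prime.
by apply/seteqP; split=> p [pA pI]; split=> //; apply/AssE.
Qed.
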